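(* Let $0<q\le 1$, let $\sigma\ge\epsilon\ge 0$ with $\|w\|_2\le\epsilon$ and $y=Ax_0+w$, and let $\mathcal X$ be the set of all (global) optimal solutions of $$(P_{q,\sigma}):\quad \min_{x\in\mathbb R^n}\ \|x\|_q\quad\text{s.t.}\quad \|y-Ax\|_2\le\sigma .$$ Let $N:=\|x_0\|_0$, let $M$ be the mutual coherence of $A$, and let $\gamma\in[1/N,n/N]$ be a constant such that for every $x^*_{q,\sigma}\in\mathcal X$ the error vector $e=x^*_{q,\sigma}-x_0$ satisfies $$(\gamma N)^{1/q-1}\|e\|_1\le\|e\|_q .$$ Suppose that $$N<\frac{\gamma^{2/q-2}(M+1)}{4^{1/q}M}.$$ Then $$\|x^*_{q,\sigma}-x_0\|_2^2\le\frac{(\epsilon+\sigma)^2}{1-M\left(\frac{4^{1/q}}{\gamma^{2/q-2}}N-1\right)}\qquad\text{for all } x^*_{q,\sigma}\in\mathcal X .$$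
   Context: $A\in\mathbb R^{m\times n}$ with $m<n$ is a real matrix (overcomplete dictionary) whose columns $A_1,\dots,A_n$ are normalized, $\|A_i\|_2=1$. Its mutual coherence is $M=M(A)=\max_{1\le i,j\le n,\ i\ne j}|A_i^TA_j|$, so $0\le M\le 1$. $\|x\|_0$ denotes the number of nonzero entries of $x$, and $\|x\|_q=\left(\sum_i|x_i|^q\right)^{1/q}$ for $0<q\le1$ (a quasi-norm when $q<1$). The vector $x_0\in\mathbb R^n$ is nonzero and is assumed to be the unique solution of $\min_x\|x\|_0$ subject to $y_0=Ax$, where $y_0=Ax_0\in\mathbb R^m$. The observed vector is $y=y_0+w\in\mathbb R^m$, where $w\in\mathbb R^m$ is noise with $\|w\|_2\le\epsilon$, and $\sigma$ is the estimate of the noise level $\epsilon$. *)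

(* Defs.v *)
From mathcomp Require Import all_boot all_order all_algebra.
From mathcomp Require Import classical_sets reals exp.

Set Implicit Arguments.
Unset Strict Implicit.
Unset Printing Implicit Defensive.

Import Order.TTheory GRing.Theory Num.Theory.

Local Open Scope classical_set_scope.
Local Open Scope ring_scope.

Definition l2norm (R : realType) (k : nat) (v : 'cV[R]_k) : R :=
  Num.sqrt (\sum_i v i 0 ^+ 2).

Definition l0norm (R : realType) (k : nat) (v : 'cV[R]_k) : nat :=
  #|[pred i | v i 0 != 0]|.

(* The powers are real powers; 0 `^ q = 0 as soon as q != 0. *)
Definition lqnorm (R : realType) (q : R) (k : nat) (v : 'cV[R]_k) : R :=
  (\sum_i `|v i 0| `^ q) `^ q^-1.

(* The default value 0 of the maximum is harmless: all terms are nonnegative. *)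
Definition mutual_coherence (R : realType) (m n : nat) (A : 'M[R]_(m, n)) : R :=
  \big[Num.max/0]_(p : 'I_n * 'I_n | p.1 != p.2)
    `|((col p.1 A)^T *m col p.2 A) 0 0|.

(* The set of global optimal solutions of  min f x  s.t.  x \in F.  The codomain
   is any ordered type, so that f can be nat-valued or real-valued. *)
Definition minimizers (T : Type) (d : Order.disp_t) (V : porderType d)
    (f : T -> V) (F : set T) : set T :=
  [set x | F x /\ forall z, F z -> (f x <= f z)%O].

(* Main.v *)
Require Import Defs.
From mathcomp Require Import all_boot all_order all_algebra.
From mathcomp Require Import classical_sets reals exp.
From mathcomp Require Import ring lra.

(** Since [x0] is feasible, a minimizer [x = x0 + e] has [lqnorm q x <= lqnorm q x0],
    so at least half of [\sum_i `|e i 0| `^ q] sits on the support of [x0].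
    Concavity of [t `^ (q / 2)] bounds that half by the l2-norm, giving
    [||e||_q ^ 2 <= 4 ^ (1 / q) N ^ (2 / q - 1) ||e||_2 ^ 2]; with the assumption on
    [gamma] this becomes [||e||_1 ^ 2 <= K N ||e||_2 ^ 2], where
    [K = 4 ^ (1 / q) / gamma ^ (2 / q - 2)].  As the off-diagonal entries of the Gram
    matrix are at most [M], [||A e||^2 >= (1 + M) ||e||_2 ^ 2 - M ||e||_1 ^ 2],
    whereas [||A e|| <= epsilon + sigma]. *)

Set Implicit Arguments.
Unset Strict Implicit.
Unset Printing Implicit Defensive.

Import Order.TTheory GRing.Theory Num.Theory.

Local Open Scope classical_set_scope.
Local Open Scope ring_scope.

(** * Concavity and Minkowski inequalities for finite sums of reals *)

Section RealInequalities.
Variable R : realType.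
Implicit Types p q s t a b : R.

(** The right-hand side is the tangent at 1 of the concave function [t ^ p]. The bound is Young's
    inequality for the product of [t ^ p] and 1, with conjugate exponents [1 / p] and
    [1 / (1 - p)]. *)
Lemma powR_le_affine p t : 0 < p < 1 -> 0 <= t -> t `^ p <= 1 - p + p * t.
Proof.
case/andP=> p0 p1 t0.
have := @conjugate_powR R (t `^ p) 1 p^-1 (1 - p)^-1.
rewrite powR_ge0 ler01 !invr_gt0 p0 subr_gt0 p1 !invrK addrC subrK.
move=> /(_ isT isT isT isT erefl).
by rewrite mulr1 -powRrM divff ?gt_eqF// powRr1// powR1 mul1r addrC mulrC.
Qed.

Lemma powR_subadditive q s t :
  0 < q <= 1 -> 0 <= s -> 0 <= t -> (s + t) `^ q <= s `^ q + t `^ q.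
Proof.
case/andP=> q0 q1 s0 t0.
have [st0|stN0] := eqVneq (s + t) 0.
  by rewrite st0 powR0 ?gt_eqF// addr_ge0 ?powR_ge0.
have st_gt0 : 0 < s + t by rewrite lt_neqAle eq_sym stN0 addr_ge0.
(* A ratio [z / (s + t)] in [0, 1] is at most its own [q]-th power; the ratios of [s] and [t] add up
   to 1. *)
have scale z : 0 <= z -> z <= s + t -> z / (s + t) * (s + t) `^ q <= z `^ q.
  rewrite le_eqVlt => /predU1P[<- _|z0 zst]; first by rewrite !mul0r powR_ge0.
  rewrite -[in leRHS](divfK stN0 z) powRM ?divr_ge0 ?(ltW z0) ?(ltW st_gt0)//.
  rewrite ler_wpM2r ?powR_ge0// ger1_powR// divr_gt0//=.
  by rewrite ler_pdivrMr// mul1r.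
have le_st : s <= s + t by rewrite lerDl.
have le_ts : t <= s + t by rewrite lerDr.
have := lerD (scale s s0 le_st) (scale t t0 le_ts).
by rewrite -mulrDl -mulrDl divff// mul1r.
Qed.

(** Jensen's inequality for the concave power [p]. Each term is bounded by the tangent at the mean
    [mu], and these affine bounds sum exactly to the value at the mean times the cardinality. *)
Lemma sum_powR_le_card (I : finType) (P : pred I) (F : I -> R) p :
  0 < p < 1 -> (forall i, 0 <= F i) ->
  \sum_(i | P i) F i `^ p
    <= #|P|%:R `^ (1 - p) * (\sum_(i | P i) F i) `^ p.
Proof.
move=> p01 F0; have /andP[p0 p1] := p01.
set B := \sum_(i | P i) F i.
have B0 : 0 <= B by apply: sumr_ge0.
have [B_eq0|BN0] := eqVneq B 0.
  have /psumr_eq0P FP0 : \sum_(i | P i) F i = 0 by [].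
  rewrite big1 ?mulr_ge0 ?powR_ge0// => i Pi.
  by rewrite FP0// powR0 ?gt_eqF.
have B_gt0 : 0 < B by rewrite lt_neqAle eq_sym BN0.
have K_gt0 : 0 < (#|P|%:R : R).
  rewrite ltr0n lt0n; apply: contra_neq BN0 => /card0_eq P0.
  by rewrite /B big_pred0.
have KN0 := lt0r_neq0 K_gt0.
pose mu := B / #|P|%:R.
have mu_gt0 : 0 < mu by rewrite divr_gt0.
have -> : #|P|%:R `^ (1 - p) * B `^ p = #|P|%:R * mu `^ p.
  rewrite -[in LHS](divfK KN0 B) -/mu powRM ?ltW// mulrCA.
  by rewrite -powRD ?KN0 ?implybT// subrK powRr1 ?(ltW K_gt0)// mulrC.
have -> : #|P|%:R * mu `^ p = \sum_(i | P i) (1 - p + p * (F i / mu)) * mu `^ p.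
  rewrite -mulr_suml big_split/= sumr_const -mulr_sumr -mulr_suml -/B.
  have -> : B / mu = #|P|%:R by rewrite invf_div mulrCA divff// mulr1.
  by rewrite -mulr_natr; ring.
apply: ler_sum => i _.
rewrite -[in leLHS](divfK (lt0r_neq0 mu_gt0) (F i)) powRM ?divr_ge0 ?(ltW mu_gt0)//.
by rewrite ler_wpM2r ?powR_ge0// powR_le_affine// divr_ge0// ltW.
Qed.

(** Minkowski's inequality with squared bounds, the source of the triangle inequality for [l2norm].
    The cases [a = 0] and [b = 0] are settled first, because the weights [b / a] and [a / b] require
    nonzero values. *)
Lemma sum_sqrD_le (I : finType) (u v : I -> R) a b :
  0 <= a -> 0 <= b -> \sum_i u i ^+ 2 <= a ^+ 2 -> \sum_i v i ^+ 2 <= b ^+ 2 ->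
  \sum_i (u i + v i) ^+ 2 <= (a + b) ^+ 2.
Proof.
have null (z : I -> R) : \sum_i z i ^+ 2 <= 0 ^+ 2 -> z =1 fun=> 0.
  rewrite expr0n/= => z_le0 i; apply/eqP; rewrite -sqrf_eq0; apply/eqP.
  apply: (@psumr_eq0P _ I predT (fun i => z i ^+ 2)) => // [j _|].
    exact: sqr_ge0.
  by apply/eqP; rewrite eq_le z_le0 sumr_ge0// => j _; exact: sqr_ge0.
rewrite le_eqVlt => /predU1P[<- b0 /null u0 hv|a0].
  by under eq_bigr do rewrite u0 add0r; rewrite add0r.
rewrite le_eqVlt => /predU1P[<- hu /null v0|b0 hu hv].
  by under eq_bigr do rewrite v0 addr0; rewrite addr0.
have ab0 : 0 < a * b by rewrite mulr_gt0.
(* Young: [2 u v <= (b / a) u^2 + (a / b) v^2] *)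
have -> : (a + b) ^+ 2 = (1 + b / a) * a ^+ 2 + (1 + a / b) * b ^+ 2.
  by field; rewrite !gt_eqF.
apply: (@le_trans _ _
  (\sum_i ((1 + b / a) * u i ^+ 2 + (1 + a / b) * v i ^+ 2))).
  apply: ler_sum => i _; rewrite -subr_ge0.
  have -> : (1 + b / a) * u i ^+ 2 + (1 + a / b) * v i ^+ 2 - (u i + v i) ^+ 2
      = (b * u i - a * v i) ^+ 2 / (a * b) by field; rewrite !gt_eqF.
  by rewrite divr_ge0 ?sqr_ge0// ltW.
by rewrite big_split/= -!mulr_sumr lerD// ler_wpM2l// addr_ge0// divr_ge0 ?(ltW a0) ?(ltW b0).
Qed.

End RealInequalities.

(** * Norms, and the error of a vector whose [q]-norm does not exceed that of [x0] *)

Section Norms.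
Variable R : realType.

Lemma sqr_l2norm k (v : 'cV[R]_k) : l2norm v ^+ 2 = \sum_i v i 0 ^+ 2.
Proof. by rewrite sqr_sqrtr// sumr_ge0// => i _; exact: sqr_ge0. Qed.

Lemma l2norm_ge0 k (v : 'cV[R]_k) : 0 <= l2norm v.
Proof. exact: sqrtr_ge0. Qed.

Lemma l2normN k (v : 'cV[R]_k) : l2norm (- v) = l2norm v.
Proof. by congr Num.sqrt; apply: eq_bigr => i _; rewrite mxE sqrrN. Qed.

Lemma ler_l2normD k (u v : 'cV[R]_k) : l2norm (u + v) <= l2norm u + l2norm v.
Proof.
rewrite -ler_sqr ?nnegrE ?addr_ge0 ?l2norm_ge0// sqr_l2norm.
under eq_bigr do rewrite mxE.
by apply: sum_sqrD_le; rewrite ?l2norm_ge0// sqr_l2norm.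
Qed.

Lemma lqnorm1E k (v : 'cV[R]_k) : lqnorm 1 v = \sum_i `|v i 0|.
Proof.
rewrite /lqnorm invr1; under eq_bigr do rewrite powRr1//.
by rewrite powRr1// sumr_ge0.
Qed.

Lemma lqnorm_powR q k (v : 'cV[R]_k) :
  0 < q -> lqnorm q v `^ q = \sum_i `|v i 0| `^ q.
Proof.
move=> q0; rewrite -powRrM mulVf ?gt_eqF// powRr1// sumr_ge0// => i _.
exact: powR_ge0.
Qed.

(** Off the support of [x0] the error equals [x]; on it, subadditivity gives
    [|x0|^q <= |e|^q + |x|^q]. Comparing the total sums for [x] and [x0] then shows that the
    off-support part of the error is at most its on-support part. *)
Lemma sum_powR_error_le q n (x x0 : 'cV[R]_n) :
  0 < q <= 1 -> lqnorm q x <= lqnorm q x0 ->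
  \sum_i `|(x - x0) i 0| `^ q
    <= 2 * \sum_(i | x0 i 0 != 0) `|(x - x0) i 0| `^ q.
Proof.
move=> q01 xx0; have /andP[q0 _] := q01.
have {}xx0 : \sum_i `|x i 0| `^ q <= \sum_i `|x0 i 0| `^ q.
  rewrite -(lqnorm_powR x q0) -(lqnorm_powR x0 q0).
  by apply: ge0_ler_powR xx0; rewrite ?nnegrE ?powR_ge0// ltW.
rewrite (bigID (fun i => x0 i 0 != 0))/= mulr2n mulrDl mul1r lerD2l.
have -> : \sum_(i | ~~ (x0 i 0 != 0)) `|(x - x0) i 0| `^ q
    = \sum_(i | ~~ (x0 i 0 != 0)) `|x i 0| `^ q.
  by apply: eq_bigr => i; rewrite negbK !mxE => /eqP->; rewrite subr0.
have : \sum_i `|x0 i 0| `^ q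
    <= \sum_(i | x0 i 0 != 0) (`|(x - x0) i 0| `^ q + `|x i 0| `^ q).
  rewrite (bigID (fun i => x0 i 0 != 0))/= [X in _ + X]big1 ?addr0; last first.
    by move=> i; rewrite negbK => /eqP->; rewrite normr0 powR0// gt_eqF.
  apply: ler_sum => i _; apply: le_trans (powR_subadditive q01 _ _) => //.
  apply: ge0_ler_powR; rewrite ?nnegrE ?addr_ge0 ?(ltW q0)//.
  rewrite !mxE distrC -[in leLHS](subrK (x i 0) (x0 i 0)).
  exact: ler_normD.
move: xx0; rewrite big_split/=.
rewrite [\sum_i `|x i 0| `^ q](bigID (fun i => x0 i 0 != 0))/=; lra.
Qed.

Lemma sqr_lqnorm_error_le q n (x x0 : 'cV[R]_n) :
  0 < q <= 1 -> lqnorm q x <= lqnorm q x0 ->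
  lqnorm q (x - x0) ^+ 2
    <= 4 `^ q^-1 * (l0norm x0)%:R `^ (2 / q - 1) * l2norm (x - x0) ^+ 2.
Proof.
move=> q01 xx0; have /andP[q0 q1] := q01.
have qN0 := lt0r_neq0 q0.
set e := x - x0; set N : R := (l0norm x0)%:R; set L := l2norm e ^+ 2.
have N0 : 0 <= N by rewrite ler0n.
have L0 : 0 <= L by rewrite sqr_ge0.
have Eq : \sum_i `|e i 0| `^ q <= 2 * (N `^ (1 - q / 2) * L `^ (q / 2)).
  apply: le_trans (sum_powR_error_le q01 xx0) _; rewrite ler_wpM2l//.
  (* Viewing [|t| ^ q] as a power [q / 2 < 1] of the square lets Jensen's inequality bring in the
     l2-norm. *)
  have sqr_powR t : `|t| `^ q = (t ^+ 2) `^ (q / 2) :> R.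
    by rewrite -real_normK ?num_real// -powR_mulrn// -powRrM; congr (_ `^ _); field.
  under eq_bigr do rewrite sqr_powR.
  apply: le_trans (sum_powR_le_card _ _ _) _ => [|i|]; rewrite ?sqr_ge0//.
    by apply/andP; split; lra.
  rewrite ler_wpM2l ?powR_ge0//; apply: ge0_ler_powR; rewrite ?nnegrE//.
  - by rewrite divr_ge0// ltW.
  - by rewrite sumr_ge0// => i _; rewrite sqr_ge0.
  rewrite /L sqr_l2norm [leRHS](bigID (fun i => x0 i 0 != 0))/= lerDl.
  by rewrite sumr_ge0// => i _; rewrite sqr_ge0.
rewrite -powR_mulrn ?powR_ge0// -powRrM.
(* Raising [Eq] to the power [2 / q] turns the factor 2 into [4 ^ (1 / q)] and makes [L] appear
   linearly. *)
have -> : 4 `^ q^-1 * N `^ (2 / q - 1) * L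
    = (2 * (N `^ (1 - q / 2) * L `^ (q / 2))) `^ (q^-1 * 2).
  rewrite powRM ?mulr_ge0 ?powR_ge0// [(N `^ _ * _) `^ _]powRM ?powR_ge0//.
  rewrite -!powRrM mulrA.
  have -> : q / 2 * (q^-1 * 2) = 1 by field.
  have -> : (1 - q / 2) * (q^-1 * 2) = 2 / q - 1 by field.
  rewrite powRr1// [q^-1 * 2]mulrC powRrM powR_mulrn//.
  by congr (_ `^ _ * _ * _); ring.
apply: ge0_ler_powR Eq; rewrite ?nnegrE ?mulr_ge0 ?powR_ge0 ?invr_ge0 ?(ltW q0)//.
by rewrite sumr_ge0// => i _; rewrite powR_ge0.
Qed.

End Norms.

(** * Lower bound on the quadratic form of the Gram matrix *)

Section Coherence.
Variables (R : realType) (m n : nat) (A : 'M[R]_(m, n)).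

Lemma mutual_coherence_ge0 : 0 <= mutual_coherence A.
Proof. exact: bigmax_ge_id. Qed.

Lemma gram_le_coherence i j :
  i != j -> `|\sum_k A k i * A k j| <= mutual_coherence A.
Proof.
move=> ij; have := @le_bigmax_cond _ R _ 0 (i, j) (fun p : 'I_n * 'I_n => p.1 != p.2)
  (fun p => `|((col p.1 A)^T *m col p.2 A) 0 0|) ij.
by rewrite mxE/=; under eq_bigr do rewrite !mxE.
Qed.

Lemma sqr_l2norm_mulmx_ge (e : 'cV[R]_n) :
  (forall i, l2norm (col i A) = 1) ->
  (1 + mutual_coherence A) * l2norm e ^+ 2
    - mutual_coherence A * (\sum_i `|e i 0|) ^+ 2 <= l2norm (A *m e) ^+ 2.
Proof.
move=> col_norm1; set M := mutual_coherence A.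
pose G i j := \sum_k A k i * A k j.
have Gii i : G i i = 1.
  rewrite -(expr1n _ 2) -(col_norm1 i) sqr_l2norm.
  by apply: eq_bigr => k _; rewrite mxE expr2.
have -> : l2norm (A *m e) ^+ 2 = \sum_i \sum_j e i 0 * e j 0 * G i j.
  rewrite sqr_l2norm.
  under eq_bigr => k _ do rewrite mxE expr2 big_distrlr/=.
  rewrite exchange_big/=; apply: eq_bigr => i _.
  rewrite exchange_big/=; apply: eq_bigr => j _.
  by rewrite mulr_sumr; apply: eq_bigr => k _; ring.
(* Both sides become double sums and are compared entry by entry: on the diagonal they agree, since
   [(1 + M) - M = 1 = G i i]; off it, [G i j >= - M] up to the signs of the entries of [e]. *)
have -> : (1 + M) * l2norm e ^+ 2 - M * (\sum_i `|e i 0|) ^+ 2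
    = \sum_i \sum_j ((i == j)%:R * (1 + M) * e i 0 ^+ 2
                     - M * (`|e i 0| * `|e j 0|)).
  rewrite sqr_l2norm expr2 big_distrlr/= !mulr_sumr -sumrB.
  apply: eq_bigr => i _; rewrite sumrB mulr_sumr; congr (_ - _).
  rewrite (bigD1 i)//= eqxx mul1r big1 ?addr0// => j; rewrite eq_sym => /negPf->.
  by rewrite !mul0r.
apply: ler_sum => i _; apply: ler_sum => j _.
have [<-|ij] := eqVneq i j.
  by rewrite mul1r Gii -!expr2 real_normK ?num_real//; lra.
rewrite !mul0r sub0r lerNl; apply: le_trans (ler_norm _) _.
rewrite normrN !normrM mulrC ler_wpM2r ?mulr_ge0//; exact: gram_le_coherence.
Qed.

End Coherence.

Theorem mainTheorem1 (R : realType) (m n : nat) (A : 'M[R]_(m, n))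
    (x0 : 'cV[R]_n) (y0 y w : 'cV[R]_m) (q epsilon sigma gamma : R) :
  let M := mutual_coherence A in
  let N : R := (l0norm x0)%:R in
  let X := minimizers (@lqnorm R q n) [set x | l2norm (y - A *m x) <= sigma] in
  (m < n)%N ->
  (forall i, l2norm (col i A) = 1) ->
  x0 != 0 ->
  y0 = A *m x0 ->
  minimizers (@l0norm R n) [set x | y0 = A *m x] = [set x0] ->
  0 < q <= 1 ->
  0 <= epsilon <= sigma ->
  l2norm w <= epsilon ->
  y = y0 + w ->
  N^-1 <= gamma <= n%:R / N ->
  (forall x, X x ->
    (gamma * N) `^ (q^-1 - 1) * lqnorm 1 (x - x0) <= lqnorm q (x - x0)) ->
  N < gamma `^ (2 / q - 2) * (M + 1) / (4 `^ q^-1 * M) ->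
  forall x, X x ->
    l2norm (x - x0) ^+ 2 <=
      (epsilon + sigma) ^+ 2 /
      (1 - M * (4 `^ q^-1 / gamma `^ (2 / q - 2) * N - 1)).
Proof.
move=> M N X _ col1 x0N0 y0E _ q01 /andP[eps0 epssig] weps yE.
move=> /andP[gamma_ge _] Herr HN x Xx.
have /andP[q0 q1] := q01.
have [x_feas x_min] := Xx.
set K := 4 `^ q^-1 / gamma `^ (2 / q - 2).
set L := l2norm (x - x0) ^+ 2.
have L0 : 0 <= L by rewrite sqr_ge0.
have M0 : 0 <= M := mutual_coherence_ge0 A.
have N_gt0 : 0 < N.
  rewrite ltr0n lt0n; apply: contra_neq x0N0 => /card0_eq x0_eq0.
  apply/matrixP => i j; rewrite mxE ord1; apply/eqP.
  by have := x0_eq0 i; rewrite !inE => /negbFE.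
have gamma_gt0 : 0 < gamma by rewrite (lt_le_trans _ gamma_ge)// invr_gt0.
have g_gt0 : 0 < gamma `^ (2 / q - 2) by rewrite powR_gt0.
have c_gt0 : 0 < (4 : R) `^ q^-1 by rewrite powR_gt0.
(* If [M = 0], the bound on [N] divides by zero; the inverse of 0 being 0, it would read [N < 0]. *)
have M_gt0 : 0 < M.
  rewrite lt_neqAle M0 andbT eq_sym; apply/eqP => Mz.
  by move: HN; rewrite Mz mulr0 invr0 mulr0 ltNge (ltW N_gt0).
(* Cleared of denominators, the bound on [N] says [K * N * M < M + 1], which is positivity of the
   final denominator. *)
have D_gt0 : 0 < 1 - M * (K * N - 1).
  move: HN; rewrite ltr_pdivlMr ?mulr_gt0// => HN.
  have : K * N * M < M + 1.
    by rewrite /K mulrAC ![_ / _ * _]mulrAC ltr_pdivrMr//; lra.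
  lra.
(* [x0] is feasible: its residual is [w], of norm at most [epsilon <= sigma]. *)
have lq_le : lqnorm q x <= lqnorm q x0.
  apply: x_min => /=.
  by rewrite yE y0E addrAC subrr add0r (le_trans weps).
have l1_le : (\sum_i `|(x - x0) i 0|) ^+ 2 <= K * N * L.
  have := le_trans _ (sqr_lqnorm_error_le q01 lq_le).
  move=> /(_ (((gamma * N) `^ (q^-1 - 1) * lqnorm 1 (x - x0)) ^+ 2)).
  rewrite ler_sqr ?nnegrE ?mulr_ge0 ?powR_ge0// Herr// => /(_ isT).
  rewrite lqnorm1E exprMn -(powR_mulrn 2 (powR_ge0 (gamma * N) _)) -powRrM.
  have -> : (q^-1 - 1) * 2 = 2 / q - 2 by ring.
  (* Splitting off one power of [N] leaves [N ^ (2 / q - 2)], which cancels against the same factor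
     of [(gamma * N) ^ (2 / q - 2)]. *)
  have -> : 2 / q - 1 = (2 / q - 2) + 1 by ring.
  rewrite powRM ?(ltW gamma_gt0) ?(ltW N_gt0)//.
  rewrite [_ `^ (_ + 1)]powRD ?(gt_eqF N_gt0) ?implybT//.
  rewrite powRr1 ?(ltW N_gt0)// -/N -/L => H.
  have Nq_gt0 : 0 < N `^ (2 / q - 2) by rewrite powR_gt0.
  rewrite /K mulrAC ![_ / _ * _]mulrAC ler_pdivlMr//.
  rewrite -(ler_pM2l Nq_gt0); move: H; congr (_ <= _); ring.
have Ae_le : l2norm (A *m (x - x0)) <= epsilon + sigma.
  (* The image of the error is the noise minus the residual of [x], of norms at most [epsilon] and
     [sigma]. *)
  have -> : A *m (x - x0) = w + - (y - A *m x).
    by rewrite yE y0E mulmxBr opprB [A *m x0 + w]addrC opprD addrCA addNKr addrC.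
  by apply: le_trans (ler_l2normD _ _) _; rewrite l2normN lerD.
rewrite ler_pdivlMr//.
apply: (@le_trans _ _ (l2norm (A *m (x - x0)) ^+ 2)); last first.
  by rewrite ler_sqr ?nnegrE ?l2norm_ge0// addr_ge0// (le_trans eps0).
apply: le_trans (sqr_l2norm_mulmx_ge _ col1); rewrite -/M -/L.
have -> : L * (1 - M * (K * N - 1)) = (1 + M) * L - M * (K * N * L) by ring.
by rewrite lerD2l lerN2 ler_wpM2l.
Qed.
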